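(* Let $B$ be a Polish metric space and let $\mathcal{X}=(X,d_X,\pi_X)$ and $\mathcal{Y}=(Y,d_Y,\pi_Y)$ be $B$-fields. Then $$d_{GH}(\mathcal{X},\mathcal{Y})=\frac12\inf_R \mathrm{dis}_{\pi_X,\pi_Y}(R),$$ where the infimum is taken over all correspondences $R$ between $X$ and $Y$.
   Context: A Polish metric space is a complete separable metric space. Fix a Polish metric space $(B,d_B)$. A $B$-field is a triple $\mathcal{X}=(X,d_X,\pi_X)$, where $(X,d_X)$ is a nonempty Polish metric space and $\pi_X\colon X\to B$ is 1-Lipschitz. An isometric embedding $\Phi\colon\mathcal{X}\Rightarrow\mathcal{Y}$ over $B$ is a distance-preserving map $\phi\colon X\to Y$ with $\pi_Y\circ\phi=\pi_X$. The Gromov-Hausdorff distance between $B$-fields (with values in $[0,\infty]$) is $d_{GH}(\mathcal{X},\mathcal{Y}) := \inf_{\mathcal{Z},\Phi,\Psi} d_H^Z(\phi(X),\psi(Y))$, where the infimum is over all $B$-fields $\mathcal{Z}=(Z,d_Z,\pi_Z)$ and all isometric embeddings $\Phi\colon\mathcal{X}\Rightarrow\mathcal{Z}$, $\Psi\colon\mathcal{Y}\Rightarrow\mathcal{Z}$ over $B$ (with underlying maps $\phi,\psi$), and $d_H^Z$ is the Hausdorff distance in $Z$. A correspondence between $X$ and $Y$ is a subset $R\subseteq X\times Y$ whose projections to $X$ and to $Y$ are both surjective. The metric field distortion of a relation $R\subseteq X\times Y$ is $$\mathrm{dis}_{\pi_X,\pi_Y}(R):=\max\Big(\sup_{(x,y),(x',y')\in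 R}|d_X(x,x')-d_Y(y,y')|,\ 2\sup_{(x,y)\in R}d_B(\pi_X(x),\pi_Y(y))\Big).$$ *)

(* Defs.v *)
From HB Require Import structures.
From mathcomp Require Import all_boot all_order all_algebra.
From mathcomp Require Import all_classical all_reals all_analysis.

Set Implicit Arguments.
Unset Strict Implicit.
Unset Printing Implicit Defensive.

Import Order.TTheory GRing.Theory Num.Theory.

Local Open Scope classical_set_scope.
Local Open Scope ring_scope.
Local Open Scope ereal_scope.

(* Completeness is the axiom of [completeType], which cannot be used directly
   since it comes with a distinguished point and thus excludes empty spaces. *)
Definition polish (R : realType) (T : metricType R) : Prop :=
  (forall F : set_system T, ProperFilter F -> cauchy F ->
     exists x : T, F --> x) /\
  (exists D : set T, countable D /\ dense D).

Record bfield (R : realType) (B : metricType R) := BField {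
  bcarrier :> metricType R ;
  bproj : bcarrier -> B ;
  bfield_nonempty : [set: bcarrier] !=set0 ;
  bfield_polish : polish bcarrier ;
  bproj_lipschitz : forall x y : bcarrier,
    (mdist (bproj x) (bproj y) <= mdist x y)%R
}.

Arguments bproj {R B b}.

Definition isometric_embedding_over (R : realType) (B : metricType R)
    (X Y : bfield B) (phi : X -> Y) : Prop :=
  (forall x x' : X, mdist (phi x) (phi x') = mdist x x') /\
  bproj \o phi = bproj.

Definition dist_to_set (R : realType) (Z : metricType R) (z : Z) (A : set Z)
    : \bar R :=
  ereal_inf [set (mdist z a)%:E | a in A].

(* Meant for nonempty sets: here [ereal_sup set0] is -oo rather than 0. *)
Definition hausdorff_dist (R : realType) (Z : metricType R) (A A' : set Z)
    : \bar R :=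
  maxe (ereal_sup [set dist_to_set a A' | a in A])
       (ereal_sup [set dist_to_set a' A | a' in A']).

Definition gromov_hausdorff_dist (R : realType) (B : metricType R)
    (X Y : bfield B) : \bar R :=
  ereal_inf [set r : \bar R |
    exists (Z : bfield B) (phi : X -> Z) (psi : Y -> Z),
      [/\ isometric_embedding_over phi, isometric_embedding_over psi
        & r = hausdorff_dist (range phi) (range psi)]].

Definition correspondence (X Y : Type) (C : set (X * Y)) : Prop :=
  fst @` C = [set: X] /\ snd @` C = [set: Y].

(* Meant for nonempty relations, as [hausdorff_dist]; a correspondence between
   B-fields is nonempty because B-fields are. *)
Definition field_distortion (R : realType) (B : metricType R)
    (X Y : bfield B) (C : set (X * Y)) : \bar R :=
  maxe
    (ereal_sup [set (`|mdist p.1 q.1 - mdist p.2 q.2|%R)%:E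
               | p in C & q in C])
    (2%:E * ereal_sup [set (mdist (bproj p.1) (bproj p.2))%:E | p in C]).

(* Main.v *)
Require Import Defs.
From HB Require Import structures.
From mathcomp Require Import all_boot all_order all_algebra.
From mathcomp Require Import all_classical all_reals all_analysis.
From mathcomp Require Import lra.

Import Order.TTheory GRing.Theory Num.Theory.
Import metricType_numDomainType.

(** A correspondence and a common ambient B-field carry the same information,
up to an arbitrarily small error.

From a correspondence [C] of distortion below [2 s], glue [X] and [Y] into the
disjoint union [X + Y], where going from [x] to [y] costs the infimum over the
pairs [p] of [C] of [mdist x p.1 + s + mdist p.2 y]. The bound [2 s] on the
difference of distances between matched pairs is exactly what lets a path that
crosses to the other space and returns, paying [s] twice, never be shorter than
the direct distance ([mdist_le_crossl], [mdist_le_crossr]); the bound [s] on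
the distance in [B] between the projections of matched points makes the joint
projection 1-Lipschitz ([glued_proj_cross]). Matched points are at distance at
most [s], so the two copies are at Hausdorff distance at most [s]. The glued
space is Polish because it is covered by isometric copies of two Polish spaces
([polish_cover]).

Conversely, if isometric copies of [X] and [Y] over [B] lie in [Z] at Hausdorff
distance below [s], then the pairs whose images are at distance below [s] form
a correspondence; the triangle inequality bounds its distance distortion by
[2 s], and the projection of [Z] being 1-Lipschitz bounds the distance between
projections of matched points by [s] ([distortion_le_hausdorff_dist]).

Both halves are run at an arbitrary real [s] strictly above the quantity of
interest ([lee_real_upper]). Strictness yields near-optimal witnesses of the
infima and makes the gap [s] of the gluing positive even when the distortion is
zero, which separates the two copies; it also disposes of infinite values. *)

Local Open Scope classical_set_scope.
Local Open Scope ring_scope.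
Local Open Scope ereal_scope.

(** * Real upper bounds on distances and distortions *)

Lemma lee_real_upper {R : realType} (x y : \bar R) :
  (forall s : R, y < s%:E -> x <= s%:E) -> x <= y.
Proof.
case: y => [r| |] upper; last 2 first.
- exact: leey.
- move: upper; case: x => [r| |] upper //.
  + by move: (upper (r - 1)%R (ltNyr _)); rewrite lee_fin => ?; exfalso; lra.
  + by have := upper 0%R (ltNyr _).
apply/lee_addgt0Pr => e e0; rewrite -EFinD; apply: upper.
by rewrite lte_fin; lra.
Qed.

Lemma hausdorff_dist_lt {R : realType} {Z : metricType R} (A A' : set Z)
    (s : R) : hausdorff_dist A A' < s%:E ->
  (forall a, A a -> exists2 a', A' a' & (mdist a a' < s)%R) /\
  (forall a', A' a' -> exists2 a, A a & (mdist a' a < s)%R).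
Proof.
rewrite /hausdorff_dist gt_max => /andP[ltA ltA']; split => a Aa.
- have : dist_to_set a A' < s%:E.
    by apply: le_lt_trans ltA; apply: ereal_sup_ubound; exists a.
  by case/ereal_inf_lt => _ [a' A'a' <-]; rewrite lte_fin; exists a'.
- have : dist_to_set a A < s%:E.
    by apply: le_lt_trans ltA'; apply: ereal_sup_ubound; exists a.
  by case/ereal_inf_lt => _ [a' A'a' <-]; rewrite lte_fin; exists a'.
Qed.

Lemma hausdorff_dist_le {R : realType} {Z : metricType R} (A A' : set Z)
    (s : R) :
  (forall a, A a -> exists2 a', A' a' & (mdist a a' <= s)%R) ->
  (forall a', A' a' -> exists2 a, A a & (mdist a' a <= s)%R) ->
  hausdorff_dist A A' <= s%:E.
Proof.
move=> nearA nearA'; rewrite /hausdorff_dist ge_max; apply/andP; split.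
- apply/ereal_supP => _ [a /nearA[a' A'a' le_s] <-].
  apply: le_trans (_ : (mdist a a')%:E <= _) => //.
  by apply: ereal_inf_lbound; exists a'.
- apply/ereal_supP => _ [a /nearA'[a' A'a' le_s] <-].
  apply: le_trans (_ : (mdist a a')%:E <= _) => //.
  by apply: ereal_inf_lbound; exists a'.
Qed.

Lemma field_distortion_leP {R : realType} {B : metricType R} {X Y : bfield B}
    (C : set (X * Y)) (s : R) :
  field_distortion C <= 2%:E * s%:E <->
  (forall p q, C p -> C q ->
     (`|mdist p.1 q.1 - mdist p.2 q.2| <= 2 * s)%R) /\
  (forall p, C p -> (mdist (bproj p.1) (bproj p.2) <= s)%R).
Proof.
rewrite /field_distortion ge_max lee_pmul2l ?lte_fin ?ltr0n//.
split=> [/andP[/ereal_supP dC /ereal_supP piC]|[dC piC]].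
  split=> [p q Cp Cq|p Cp].
    by rewrite -lee_fin EFinM; apply: dC; exists p => //; exists q.
  by rewrite -lee_fin; apply: piC; exists p.
apply/andP; split; apply/ereal_supP.
  by move=> _ [p Cp [q Cq <-]]; rewrite -EFinM lee_fin; exact: dC.
by move=> _ [p Cp <-]; rewrite lee_fin; exact: piC.
Qed.

(** * Polish spaces covered by two isometric copies *)

(** The traces of [F] on the copy of [X] form a Cauchy filter of [X]; its limit
is a cluster point of [F], and a Cauchy filter converges to any of its cluster
points. *)
Lemma cvg_of_isometry_trace {R : realType} {X Z : metricType R} (f : X -> Z)
    (F : set_system Z) :
  polish X -> (forall x x', mdist (f x) (f x') = mdist x x') ->
  ProperFilter F -> cauchy F ->
  (forall A, F A -> A `&` range f !=set0) ->
  exists z : Z, F --> z.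
Proof.
move=> [complX _] isof FF /cauchyP Fc meetf.
pose G := filter_from F (fun A => f @^-1` A).
have GF : ProperFilter G.
  apply: filter_from_proper => [|A FA].
    apply: filter_from_filter; first by exists setT; exact: filterT.
    by move=> A A' FA FA'; exists (A `&` A') => //; exact: filterI.
  by have [w [Aw [x _ fxE]]] := meetf _ FA; exists x; rewrite /= fxE.
have Gc : cauchy G.
  apply/cauchyP => e e0.
  (* the center given for F may lie outside the copy of X: moving it to a point
     of the trace doubles the radius *)
  have [z Fz] := Fc _ (divr_gt0 e0 (ltr0n _ 2)).
  have [w [zfx [x _ fxE]]] := meetf _ Fz.
  exists x; exists (ball z (e / 2)%R) => //= x'.
  rewrite -fxE !ballEmdist/= in zfx * => zfx'.
  rewrite -isof (le_lt_trans (metric_triangle _ z _))//.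
  by rewrite (metric_sym _ z); lra.
have [x Gx] := complX _ GF Gc.
exists (f x); apply/fcvgrPdist_lt => e e0.
have e4 : (0 < e / 4)%R by rewrite divr_gt0.
have [z Fz] := Fc _ e4.
have [A FA Ax] : G [set x' | mdist x x' < e / 4]%R.
  by move/fcvgrPdist_lt: Gx; exact.
have [w [[Aw zfx'] [x' _ fx'E]]] := meetf _ (filterI FA Fz).
have xx' : (mdist x x' < e / 4)%R by apply: Ax; rewrite /= fx'E.
rewrite -fx'E ballEmdist/= in zfx'.
apply: filterS Fz => v; rewrite ballEmdist/= => zv.
have := metric_triangle (f x) (f x') v; have := metric_triangle (f x') z v.
by rewrite isof (metric_sym (f x') z); lra.
Qed.

(** A member of a Cauchy filter that misses one of the two copies is contained
in the other one, so at least one of the copies meets all the members. *)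
Lemma polish_cover {R : realType} {X Y Z : metricType R}
    (f : X -> Z) (g : Y -> Z) :
  polish X -> polish Y ->
  (forall x x', mdist (f x) (f x') = mdist x x') ->
  (forall y y', mdist (g y) (g y') = mdist y y') ->
  range f `|` range g = setT -> polish Z.
Proof.
move=> polX polY isof isog cover; split=> [F FF Fc|].
  have [meetf|] := pselect (forall A, F A -> A `&` range f !=set0).
    exact: cvg_of_isometry_trace meetf.
  move=> /existsNP[A /not_implyP[FA Af]].
  apply: (cvg_of_isometry_trace g) => // A' FA'.
  have [w [Aw A'w]] := filter_ex (filterI FA FA').
  exists w; split=> //.
  have : [set: Z] w by [].
  by rewrite -cover => -[fw|//]; case: Af; exists w.
have [[_ [D [Dc Dd]]] [_ [E [Ec Ed]]]] := (polX, polY).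
exists (f @` D `|` g @` E); split.
  rewrite -bigcup2E; apply: bigcup_countable => // -[|[|n]] _ /=.
  - by apply: sub_countable Dc; exact: card_image_le.
  - by apply: sub_countable Ec; exact: card_image_le.
  - exact: countable0.
have hits (T : metricType R) (h : T -> Z) (S : set T) (O : set Z) (t : T) :
    (forall t t', mdist (h t) (h t') = mdist t t') -> dense S ->
    open O -> O (h t) -> O `&` h @` S !=set0.
  move=> isoh Sd Oo Ot.
  have /nbhs_ballP[e /= e0 Oe] : nbhs (h t) O by exact: open_nbhs_nbhs.
  have [] := Sd (interior (ball t e)).
  - by exists t; exact: nbhsx_ballx.
  - exact: open_interior.
  move=> t' [/interior_subset]; rewrite ballEmdist/= => tt' St'.
  exists (h t'); split; last by exists t'.
  by apply: Oe; rewrite ballEmdist/= isoh.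
move=> O [w Ow] Oo; rewrite setIUr.
have : [set: Z] w by [].
rewrite -cover => -[[x _ xw]|[y _ yw]]; subst w.
  by have [v] := hits _ _ _ _ _ isof Dd Oo Ow; exists v; left.
by have [v] := hits _ _ _ _ _ isog Ed Oo Ow; exists v; right.
Qed.

(** * Gluing two metric spaces along a relation *)

Record gluing {R : realType} (X Y : metricType R) := Gluing {
  grel : set (X * Y) ;
  ggap : R ;
  grel_neq0 : grel !=set0 ;
  ggap_gt0 : (0 < ggap)%R ;
  ggap_dist : forall p q, grel p -> grel q ->
    (`|mdist p.1 q.1 - mdist p.2 q.2| <= 2 * ggap)%R
}.

Arguments Gluing {R X Y}.
Arguments grel {R X Y}.
Arguments ggap {R X Y}.
Arguments grel_neq0 {R X Y}.
Arguments ggap_gt0 {R X Y}.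
Arguments ggap_dist {R X Y}.

(** The metric depends on [G], so the disjoint union is given a name that
mentions it: instance inference can then recover the relation and the gap. *)
Definition glued {R : realType} {X Y : metricType R} (G : gluing X Y) : Type :=
  (X + Y)%type.

Section glued_metric.
Local Open Scope ring_scope.
Context {R : realType} {X Y : metricType R} (G : gluing X Y).

(** The cheapest path from [x] to [y] that crosses once, through a pair of the
relation, at the price of the gap. *)
Definition cross (x : X) (y : Y) : R :=
  inf [set mdist x p.1 + ggap G + mdist p.2 y | p in grel G].

Lemma cross_le p x y : grel G p ->
  cross x y <= mdist x p.1 + ggap G + mdist p.2 y.
Proof.
move=> Gp; apply: ge_inf; last by exists p.
exists 0 => _ [q _ <-].
by rewrite !addr_ge0 ?mdist_ge0// ltW// ggap_gt0.
Qed.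

Lemma le_cross a x y :
  (forall p, grel G p -> a <= mdist x p.1 + ggap G + mdist p.2 y) ->
  a <= cross x y.
Proof.
move=> le_a; apply: lb_le_inf.
  by have [p Gp] := grel_neq0 G; eexists; exists p.
by move=> _ [p Gp <-]; exact: le_a.
Qed.

Lemma cross_gt0 x y : 0 < cross x y.
Proof.
apply: lt_le_trans (ggap_gt0 G) _; apply: le_cross => p _.
by have := mdist_ge0 x p.1; have := mdist_ge0 p.2 y; lra.
Qed.

Lemma cross_trianglel x x' y : cross x y <= mdist x x' + cross x' y.
Proof.
rewrite addrC -lerBlDr; apply: le_cross => p Gp.
by have := cross_le p x y Gp; have := metric_triangle x x' p.1; lra.
Qed.

Lemma cross_triangler x y y' : cross x y <= cross x y' + mdist y' y.
Proof.
rewrite -lerBlDr; apply: le_cross => p Gp.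
by have := cross_le p x y Gp; have := metric_triangle p.2 y' y; lra.
Qed.

(** Leaving [X] through [p] and coming back through [q] replaces the segment
from [p.1] to [q.1] by the one from [p.2] to [q.2], which saves at most
[2 * ggap G]: what the two crossings cost. *)
Lemma mdist_le_crossl x x' y : mdist x x' <= cross x y + cross x' y.
Proof.
rewrite -lerBlDr; apply: le_cross => p Gp.
rewrite lerBlDr -lerBlDl; apply: le_cross => q Gq.
have := ggap_dist G _ _ Gp Gq; rewrite ler_norml => /andP[_ pq].
have := metric_triangle x p.1 x'; have := metric_triangle p.1 q.1 x'.
have := metric_triangle p.2 y q.2.
by rewrite (metric_sym q.1 x') (metric_sym y q.2); lra.
Qed.

Lemma mdist_le_crossr x y y' : mdist y y' <= cross x y + cross x y'.
Proof.
rewrite -lerBlDr; apply: le_cross => p Gp.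
rewrite lerBlDr -lerBlDl; apply: le_cross => q Gq.
have := ggap_dist G _ _ Gp Gq; rewrite ler_norml => /andP[pq _].
have := metric_triangle y p.2 y'; have := metric_triangle p.2 q.2 y'.
have := metric_triangle p.1 x q.1.
by rewrite (metric_sym p.1 x) (metric_sym y p.2); lra.
Qed.

Definition glued_dist (u v : glued G) : R :=
  match u, v with
  | inl x, inl x' => mdist x x'
  | inr y, inr y' => mdist y y'
  | inl x, inr y | inr y, inl x => cross x y
  end.

Lemma glued_distxx u : glued_dist u u = 0.
Proof. by case: u => t; exact: mdistxx. Qed.

Lemma glued_dist_positivity u v : glued_dist u v = 0 -> u = v.
Proof.
case: u v => [x|y] [x'|y'] /=.
- by move/mdist_positivity ->.
- by move=> c0; have := cross_gt0 x y'; rewrite c0 ltxx.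
- by move=> c0; have := cross_gt0 x' y; rewrite c0 ltxx.
- by move/mdist_positivity ->.
Qed.

Lemma glued_dist_sym u v : glued_dist u v = glued_dist v u.
Proof. by case: u v => [x|y] [x'|y'] //=; exact: metric_sym. Qed.

Lemma glued_dist_triangle v u w :
  glued_dist u w <= glued_dist u v + glued_dist v w.
Proof.
case: u v w => [x|y] [x'|y'] [x''|y''] /=.
- exact: metric_triangle.
- exact: cross_trianglel.
- exact: mdist_le_crossl.
- exact: cross_triangler.
- by rewrite addrC (metric_sym x'); exact: cross_trianglel.
- exact: mdist_le_crossr.
- by rewrite addrC (metric_sym y); exact: cross_triangler.
- exact: metric_triangle.
Qed.

HB.instance Definition _ := Choice.copy (glued G) (X + Y)%type.
HB.instance Definition _ := isMetric.Build R (glued G)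
  glued_distxx glued_dist_positivity glued_dist_sym glued_dist_triangle.

Lemma polish_glued : polish X -> polish Y -> polish (glued G).
Proof.
move=> polX polY.
apply: (@polish_cover _ _ _ (glued G) inl inr) => //.
by apply/seteqP; split=> // -[x|y] _; [left; exists x|right; exists y].
Qed.

End glued_metric.

(** * The glued field *)

Section glued_field.
Context {R : realType} {B : metricType R} {X Y : bfield B} (G : gluing X Y).
Context (proj_close : forall p, grel G p ->
  (mdist (bproj p.1) (bproj p.2) <= ggap G)%R).

Definition glued_proj (u : glued G) : B :=
  match u with inl x => bproj x | inr y => bproj y end.

Lemma glued_proj_cross x y :
  (mdist (bproj x) (bproj y) <= cross G x y)%R.
Proof.
apply: le_cross => p Gp.
have := metric_triangle (bproj x) (bproj p.1) (bproj y).
have := metric_triangle (bproj p.1) (bproj p.2) (bproj y).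
have := bproj_lipschitz x p.1; have := bproj_lipschitz p.2 y.
by have := proj_close _ Gp; lra.
Qed.

Lemma glued_proj_lipschitz (u v : glued G) :
  (mdist (glued_proj u) (glued_proj v) <= mdist u v)%R.
Proof.
case: u v => [x|y] [x'|y'] /=.
- exact: bproj_lipschitz.
- exact: glued_proj_cross.
- by rewrite metric_sym; exact: glued_proj_cross.
- exact: bproj_lipschitz.
Qed.

Lemma glued_nonempty : [set: glued G] !=set0.
Proof. by have [x _] := bfield_nonempty X; exists (inl x). Qed.

Definition glued_field : bfield B :=
  BField glued_nonempty (polish_glued G (bfield_polish X) (bfield_polish Y))
    glued_proj_lipschitz.

Lemma gromov_hausdorff_dist_le_ggap :
  correspondence (grel G) -> gromov_hausdorff_dist X Y <= (ggap G)%:E.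
Proof.
move=> [surjX surjY].
pose phi : X -> glued_field := inl; pose psi : Y -> glued_field := inr.
have close p : grel G p -> (cross G p.1 p.2 <= ggap G)%R.
  by move=> Gp; have := cross_le G p p.1 p.2 Gp; rewrite !mdistxx addr0 add0r.
apply: le_trans (_ : hausdorff_dist (range phi) (range psi) <= _).
  by apply: ereal_inf_lbound; exists glued_field, phi, psi.
apply: hausdorff_dist_le.
- move=> _ [x _ <-]; have : [set: X] x by [].
  rewrite -surjX => -[p Gp <-].
  by exists (psi p.2); [exists p.2|exact: close].
- move=> _ [y _ <-]; have : [set: Y] y by [].
  rewrite -surjY => -[p Gp <-].
  by exists (phi p.1); [exists p.1|exact: close].
Qed.

End glued_field.

(** * The two inequalities *)

Lemma gromov_hausdorff_dist_le_distortion {R : realType} {B : metricType R}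
    (X Y : bfield B) (C : set (X * Y)) : correspondence C ->
  2%:E * gromov_hausdorff_dist X Y <= field_distortion C.
Proof.
move=> corrC; have [x0 _] := bfield_nonempty X.
have C0 : C !=set0.
  have : [set: X] x0 by [].
  by rewrite -(proj1 corrC) => -[p Cp _]; exists p.
have dis_ge0 : 0 <= field_distortion C.
  have [p Cp] := C0.
  rewrite /field_distortion le_max; apply/orP; left.
  apply: ereal_sup_ubound; exists p => //; exists p => //.
  by rewrite !mdistxx subrr normr0.
rewrite -lee_pdivlMl; last by rewrite ltr0n.
apply: lee_real_upper => s; rewrite lte_pdivrMl ?ltr0n// => dis_lt.
have s0 : (0 < s)%R.
  by have := le_lt_trans dis_ge0 dis_lt; rewrite -EFinM lte_fin; lra.
have /field_distortion_leP[dC piC] := ltW dis_lt.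
exact: (@gromov_hausdorff_dist_le_ggap _ _ _ _ (Gluing C s C0 s0 dC)).
Qed.

Lemma distortion_le_hausdorff_dist {R : realType} {B : metricType R}
    (X Y Z : bfield B) (phi : X -> Z) (psi : Y -> Z) :
  isometric_embedding_over phi -> isometric_embedding_over psi ->
  ereal_inf [set field_distortion C
            | C in [set C : set (X * Y) | correspondence C]]
  <= 2%:E * hausdorff_dist (range phi) (range psi).
Proof.
move=> [isophi piphi] [isopsi pipsi].
rewrite -lee_pdivrMl ?ltr0n//; apply: lee_real_upper => s.
move=> /hausdorff_dist_lt[nearX nearY].
rewrite lee_pdivrMl ?ltr0n//.
pose C := [set p : X * Y | mdist (phi p.1) (psi p.2) < s]%R.
apply: le_trans (_ : field_distortion C <= _).
  apply: ereal_inf_lbound; exists C => //; split; apply/seteqP; split=> // t _.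
    by have [|_ [y _ <-] lt_s] := nearX (phi t); [exists t|exists (t, y)].
  have [|_ [x _ <-] lt_s] := nearY (psi t); first by exists t.
  by exists (x, t) => //; rewrite /C/= metric_sym.
apply/field_distortion_leP; split=> [p q|p]; rewrite /C/= => Cp.
  move=> Cq; rewrite -isophi -isopsi ler_norml.
  have := metric_triangle (phi p.1) (psi p.2) (phi q.1).
  have := metric_triangle (psi p.2) (psi q.2) (phi q.1).
  have := metric_triangle (psi p.2) (phi p.1) (psi q.2).
  have := metric_triangle (phi p.1) (phi q.1) (psi q.2).
  rewrite (metric_sym (psi q.2) (phi q.1)) (metric_sym (psi p.2) (phi p.1)).
  by lra.
have -> : bproj p.1 = bproj (phi p.1) by rewrite -piphi.
have -> : bproj p.2 = bproj (psi p.2) by rewrite -pipsi.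
exact: le_trans (bproj_lipschitz _ _) (ltW Cp).
Qed.

Theorem theorem2p10 (R : realType) (B : metricType R) (polishB : polish B)
    (X Y : bfield B) :
  gromov_hausdorff_dist X Y =
  (2^-1)%:E * ereal_inf [set field_distortion C
                        | C in [set C : set (X * Y) | correspondence C]].
Proof.
apply/eqP; rewrite eq_le; apply/andP; split.
  rewrite lee_pdivlMl ?ltr0n//; apply/ereal_infP => _ [C corrC <-].
  exact: gromov_hausdorff_dist_le_distortion.
apply/ereal_infP => _ [Z [phi [psi [isophi isopsi ->]]]].
rewrite lee_pdivrMl ?ltr0n//.
exact: distortion_le_hausdorff_dist.
Qed.
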